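(* Let $\alpha$ be a badly-approximable real number and let $X=\{\sqrt{n}\,e^{2\pi i\alpha n} : n\in\mathbb{N}\}\subseteq\mathbb{C}\cong\mathbb{R}^2$ be the Fermat spiral with angle difference $\alpha$. Then every Chabauty limit of $X$ is a translate of a lattice in $\mathbb{R}^2$.
   Context: A number $\alpha\notin\mathbb{Q}$ with continued fraction convergents $p_j/q_j$ is badly-approximable if $0<c_\alpha:=\liminf_j q_j|q_j\alpha-p_j|$. The Chabauty–Fell topology on the set of closed subsets of $\mathbb{R}^d$ is given by the metric $d(A,B)=\min\{1,\Delta(A,B)\}$, where $\Delta(A,B)=\inf\{\epsilon>0 : B_{1/\epsilon}(0)\cap A\subseteq\mathcal{N}_\epsilon(B),\ B_{1/\epsilon}(0)\cap B\subseteq\mathcal{N}_\epsilon(A)\}$, $\mathcal{N}_\epsilon(A)=\bigcup_{x\in A}B_\epsilon(x)$, and $B_r(x)$ is the Euclidean ball. A Chabauty limit of a closed set $X\subseteq\mathbb{R}^d$ is the limit (if it exists), in this topology, of $T_nX$ for a sequence $T_n$ of translations of $\mathbb{R}^d$ with $T_n(0)\to\infty$. A lattice in $\mathbb{R}^2$ is a discrete subgroup of rank 2. *)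

(* Defs.v *)
From HB Require Import structures.
From mathcomp Require Import all_boot all_order all_algebra.
From mathcomp Require Import all_classical all_reals all_analysis.

Set Implicit Arguments.
Unset Strict Implicit.
Unset Printing Implicit Defensive.

Import Order.TTheory GRing.Theory Num.Theory.
Import numFieldNormedType.Exports.

Local Open Scope classical_set_scope.
Local Open Scope ring_scope.

(* [cf_tail a n] is the n-th complete quotient of a.  For rational a it ends in
   junk (0^-1 = 0); below it is only used for irrational a. *)
Fixpoint cf_tail (R : realType) (a : R) (n : nat) : R :=
  if n is m.+1 then (cf_tail a m - (Num.floor (cf_tail a m))%:~R)^-1 else a.

Definition cf_coef (R : realType) (a : R) (n : nat) : int :=
  Num.floor (cf_tail a n).

(* The convergents p_n / q_n of [a_0; a_1, a_2, ...]:
   p_0 = a_0, p_1 = a_1 a_0 + 1, p_n = a_n p_(n-1) + p_(n-2),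
   q_0 = 1,   q_1 = a_1,         q_n = a_n q_(n-1) + q_(n-2). *)
Fixpoint cf_num (R : realType) (a : R) (n : nat) : int :=
  match n with
  | 0 => cf_coef a 0
  | 1 => cf_coef a 1 * cf_coef a 0 + 1
  | (m.+1 as m1).+1 => cf_coef a n * cf_num a m1 + cf_num a m
  end.

Fixpoint cf_den (R : realType) (a : R) (n : nat) : int :=
  match n with
  | 0 => 1
  | 1 => cf_coef a 1
  | (m.+1 as m1).+1 => cf_coef a n * cf_den a m1 + cf_den a m
  end.

Definition badly_approximable (R : realType) (a : R) : Prop :=
  irrational a /\
  (0 < limn_einf (fun j : nat =>
         ((cf_den a j)%:~R *
          `|(cf_den a j)%:~R * a - (cf_num a j)%:~R|)%:E))%E.

(* The library norm on ['rV[R]_d] is the sup norm (it induces the same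
   topology), hence the explicit Euclidean norm. *)
Definition enorm (R : realType) (d : nat) (x : 'rV[R]_d) : R :=
  Num.sqrt (\sum_(i < d) x 0 i ^+ 2).

Definition eball (R : realType) (d : nat) (x : 'rV[R]_d) (r : R) :
    set 'rV[R]_d :=
  [set y | enorm (y - x) < r].

Definition nbhd (R : realType) (d : nat) (e : R) (A : set 'rV[R]_d) :
    set 'rV[R]_d :=
  \bigcup_(x in A) eball x e.

(* The infimum is taken in the extended reals, so that it is +oo when no e
   qualifies (the infimum of the empty set in R would be 0). *)
Definition chabauty_Delta (R : realType) (d : nat) (A B : set 'rV[R]_d) :
    \bar R :=
  ereal_inf [set e%:E | e in [set e : R |
    [/\ 0 < e,
        eball 0 e^-1 `&` A `<=` nbhd e B &
        eball 0 e^-1 `&` B `<=` nbhd e A]]].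

Definition chabauty_dist (R : realType) (d : nat) (A B : set 'rV[R]_d) : R :=
  fine (Order.min 1%E (chabauty_Delta A B)).

Definition translate (R : realType) (d : nat) (v : 'rV[R]_d)
    (A : set 'rV[R]_d) : set 'rV[R]_d :=
  [set x + v | x in A].

(* T_n is the translation by v n, so that T_n(0) = v n. *)
Definition chabauty_limit (R : realType) (d : nat) (X Y : set 'rV[R]_d) :
    Prop :=
  closed Y /\
  exists v : nat -> 'rV[R]_d,
    enorm (v n) @[n --> \oo] --> +oo /\
    chabauty_dist (translate (v n) X) Y @[n --> \oo] --> (0 : R).

Definition Zindependent (V : zmodType) (r : nat) (u : 'I_r -> V) : Prop :=
  forall c : 'I_r -> int,
    \sum_(i < r) u i *~ c i = 0 -> forall i, c i = 0.

(* The rank of an abelian group: the largest size of a Z-independent family. *)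
Definition has_rank (V : zmodType) (L : set V) (r : nat) : Prop :=
  (exists u : 'I_r -> V, (forall i, L (u i)) /\ Zindependent u) /\
  (forall u : 'I_r.+1 -> V, (forall i, L (u i)) -> ~ Zindependent u).

Definition planar_lattice (R : realType) (L : set 'rV[R]_2) : Prop :=
  [/\ zmod_closed [in L], L `<=` isolated L & has_rank L 2].

(* r e^(i t) under the identification of C with R^2. *)
Definition polar (R : realType) (r t : R) : 'rV[R]_2 :=
  \row_(i < 2) (if i == 0 then r * cos t else r * sin t).

Definition fermat_spiral (R : realType) (a : R) : set 'rV[R]_2 :=
  range (fun n : nat => polar (Num.sqrt n%:R) (2 * pi * a * n%:R)).

(* Main.v *)
Require Import Defs.
From HB Require Import structures.
From mathcomp Require Import all_boot all_order all_algebra.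
From mathcomp Require Import all_classical all_reals all_analysis.
From mathcomp Require Import complex.
From mathcomp Require Import ring lra zify.

(** Around a far away centre, the Fermat spiral looks like an affine lattice:
    an index shift that causes a bounded displacement near a centre of modulus r
    displaces all nearby points by the same vector up to O(1/r).  Instead of extracting a
    convergent subsequence of lattices, the proof passes three metric
    properties of the spiral x_n = sqrt n * exp(2 i pi a n) to a limit Y.

    - Separation ([spiral_separated]): distinct points of the spiral stay at
      distance at least sqrt kappa / 2, where kappa > 0 is a lower bound of
      |m| |m a - k| for all integers k and m <> 0.
    - Relative density ([spiral_relatively_dense]): some fixed radius rho is
      such that every point of the plane is within rho of the spiral.
    - Approximate parallelograms ([spiral_parallelogram]): if x_i and x_j are
      at bounded distance from x_c, then x_(i+j-c) is at distance
      O(1/sqrt c) from x_i + x_j - x_c.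

    When the translation vectors go to infinity the error in the third property
    vanishes, so Y, being closed, is stable under x + y - z.  Hence Y - v is a
    subgroup for any v in Y; it is discrete by separation and has rank 2,
    at least 2 by density and at most 2 by a pigeonhole count
    ([discrete_rank_le2]).

    The arithmetic input is the existence of kappa ([badly_approximableP]), which
    extends the hypothesis from the convergents to all fractions, and a form of
    the Dirichlet theorem with coprime fractions ([cf_dirichlet]); both follow
    from the determinant identity and the error bound for convergents. *)

Set Implicit Arguments.
Unset Strict Implicit.
Unset Printing Implicit Defensive.

Import Order.TTheory GRing.Theory Num.Theory.
Import numFieldNormedType.Exports.
Import Normc.

Local Open Scope classical_set_scope.
Local Open Scope ring_scope.

(** * Convergents and badly approximable numbers *)

Section ContinuedFraction.
Variables (R : realType) (a : R).
Hypothesis a_irr : irrational a.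

Lemma irrational_frac_inv (x : R) (z : int) :
  irrational x -> irrational (x - z%:~R)^-1.
Proof.
move=> xirr [r _ rE]; apply: xirr; exists (r^-1 + z%:Q) => //.
by rewrite rmorphD /= fmorphV /= rE invrK ratr_int subrK.
Qed.

Lemma irrational_neq_int (x : R) (z : int) : irrational x -> x != z%:~R.
Proof.
by move=> xirr; apply/eqP => xz; apply: xirr; exists z%:Q; rewrite // ratr_int.
Qed.

Lemma cf_tail_irrational n : irrational (cf_tail a n).
Proof. by elim: n => //= n IH; exact: irrational_frac_inv. Qed.

Lemma cf_tail_frac n :
  0 < cf_tail a n - (cf_coef a n)%:~R < 1.
Proof.
rewrite /cf_coef subr_gt0 ltrBlDl lt_neqAle eq_sym.
rewrite irrational_neq_int; last exact: cf_tail_irrational.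
by rewrite floor_le -intrD1 floorD1_gt.
Qed.

Lemma cf_tailS n :
  cf_tail a n.+1 * (cf_tail a n - (cf_coef a n)%:~R) = 1.
Proof.
by rewrite /= mulVf// gt_eqF//; case/andP: (cf_tail_frac n).
Qed.

Lemma cf_tail_gt1 n : 1 < cf_tail a n.+1.
Proof.
by rewrite /=; have /andP[? ?] := cf_tail_frac n; rewrite invf_gt1.
Qed.

Lemma cf_coef_ge1 n : 1 <= cf_coef a n.+1.
Proof.
by rewrite /cf_coef floor_ge_int ltW //=; exact: cf_tail_gt1.
Qed.

Lemma cf_denSS n :
  cf_den a n.+2 = cf_coef a n.+2 * cf_den a n.+1 + cf_den a n.
Proof. by []. Qed.

Lemma cf_numSS n :
  cf_num a n.+2 = cf_coef a n.+2 * cf_num a n.+1 + cf_num a n.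
Proof. by []. Qed.

(** The growth bound makes the denominators unbounded, which is what locating
    an integer between two consecutive ones requires. *)
Lemma cf_den_gt0_ge n : 0 < cf_den a n /\ n%:Z <= cf_den a n.
Proof.
suff: (0 < cf_den a n /\ n%:Z <= cf_den a n) /\
      (0 < cf_den a n.+1 /\ n.+1%:Z <= cf_den a n.+1) by case.
elim: n => [|n [[h1 h2] [h3 h4]]].
  by have := cf_coef_ge1 0; rewrite /=; lia.
split=> //; rewrite cf_denSS; have := cf_coef_ge1 n.+1; nia.
Qed.

Lemma cf_den_gt0 n : 0 < cf_den a n. Proof. by case: (cf_den_gt0_ge n). Qed.

Lemma cf_det n :
  cf_num a n.+1 * cf_den a n - cf_num a n * cf_den a n.+1 = (-1) ^+ n.
Proof.
elim: n => [|n IH]; first by rewrite /=; ring.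
by rewrite cf_denSS cf_numSS exprS -IH; ring.
Qed.

Definition cf_err n : R := (cf_den a n)%:~R * a - (cf_num a n)%:~R.

(** Each error is the previous one divided by a complete quotient, with a sign
    change; in particular the signs alternate. *)
Lemma cf_errS n : cf_err n.+1 * cf_tail a n.+2 = - cf_err n.
Proof.
elim: n => [|n IH]; last first.
  have h := cf_tailS n.+2.
  have {IH}IH : cf_err n = - cf_err n.+1 * cf_tail a n.+2 by rewrite mulNr IH opprK.
  rewrite {1}/cf_err cf_denSS cf_numSS.
  have -> : (cf_coef a n.+2 * cf_den a n.+1 + cf_den a n)%:~R * a -
    (cf_coef a n.+2 * cf_num a n.+1 + cf_num a n)%:~R =
    (cf_coef a n.+2)%:~R * cf_err n.+1 + cf_err n.
    by rewrite /cf_err !rmorphD !rmorphM /=; ring.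
  move: h => /(congr1 (fun x => - cf_err n.+1 * x)); rewrite mulr1 => <-.
  rewrite IH; ring.
have h1 := cf_tailS 0; have h2 := cf_tailS 1.
have -> : cf_err 0 = a - (cf_coef a 0)%:~R by rewrite /cf_err /= mul1r.
have -> : cf_err 1 = (cf_coef a 1)%:~R * (a - (cf_coef a 0)%:~R) - 1.
  by rewrite /cf_err /= rmorphD rmorphM /=; ring.
move: h2 => /(congr1 (fun x => - (a - (cf_coef a 0)%:~R) * x)).
rewrite mulr1 => <-; rewrite -[X in _ - X]h1 [cf_tail a 0]/=; ring.
Qed.

(** With e_n the errors, the determinant identity reads
    q_(n+1) e_n - q_n e_(n+1) = (-1)^n, and the two terms on the left have the
    same sign. *)
Lemma cf_err_den n : `|cf_err n| * (cf_den a n.+1)%:~R < 1.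
Proof.
have t1 := cf_tail_gt1 n.+1.
have t0 : cf_tail a n.+2 != 0 by rewrite gt_eqF// (lt_trans _ t1).
have q0 : 0 < (cf_den a n)%:~R :> R by rewrite ltr0z cf_den_gt0.
have q1 : 0 < (cf_den a n.+1)%:~R :> R by rewrite ltr0z cf_den_gt0.
have E : cf_err n * ((cf_den a n.+1)%:~R + (cf_den a n)%:~R / cf_tail a n.+2)
    = (-1) ^+ n.
  have -> : (-1) ^+ n = ((-1) ^+ n)%:~R :> R by rewrite rmorphXn /= rmorphN.
  have -> : ((-1) ^+ n)%:~R =
      (cf_den a n.+1)%:~R * cf_err n - (cf_den a n)%:~R * cf_err n.+1.
    by rewrite -cf_det rmorphB !rmorphM /= /cf_err; ring.
  have -> : cf_err n.+1 = - (cf_err n / cf_tail a n.+2).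
    by rewrite -[LHS](mulfK t0) cf_errS mulNr.
  ring.
have F : 0 < (cf_den a n)%:~R / cf_tail a n.+2 :> R.
  by rewrite divr_gt0// (lt_trans _ t1).
have : `|cf_err n| * ((cf_den a n.+1)%:~R + (cf_den a n)%:~R / cf_tail a n.+2) = 1.
  rewrite -[X in _ * X]gtr0_norm ?addr_gt0// -normrM E normrX normrN1 expr1n //.
have := normr_ge0 (cf_err n); move: F q1.
set A := _ / _; set B := `|_|; set C := _%:~R => hA hC hB; nra.
Qed.

Lemma cf_err_neq0 n : cf_err n != 0.
Proof.
apply/eqP => e; apply: a_irr.
exists ((cf_num a n)%:~R / (cf_den a n)%:~R) => //.
rewrite fmorph_div /= !ratr_int; apply: canLR (mulfK _) _.
  by rewrite intr_eq0 gt_eqF// cf_den_gt0.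
by apply/eqP; rewrite eq_sym mulrC -subr_eq0; apply/eqP.
Qed.

Lemma cf_den_locate (m : int) : 0 < m -> exists n, cf_den a n <= m < cf_den a n.+1.
Proof.
move=> m0.
have [n nP] : exists n, m < cf_den a n.+1.
  by exists `|m|%N; have [_] := cf_den_gt0_ge `|m|.+1; lia.
case: (ex_minnP (ex_intro (fun n => m < cf_den a n.+1) n nP)) => k kP kmin.
exists k; rewrite kP andbT; case: k kP kmin => [|k] kP kmin.
  by rewrite /=; lia.
by rewrite leNgt; apply/negP => /kmin; rewrite ltnn.
Qed.

(** The determinant identity is a Bezout relation. *)
Lemma cf_coprime n : coprimez (cf_num a n) (cf_den a n).
Proof.
apply/coprimezP; exists ((-1) ^+ n.+1 * cf_den a n.+1, (-1) ^+ n * cf_num a n.+1).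
rewrite /= exprS.
transitivity ((-1) ^+ n * (cf_num a n.+1 * cf_den a n - cf_num a n * cf_den a n.+1)).
  by ring.
by rewrite cf_det -expr2 sqrr_sign.
Qed.

(** The convergent whose denominator is the last one not exceeding Q. *)
Lemma cf_dirichlet (Q : R) : 1 <= Q ->
  exists p q : int, [/\ 0 < q, coprimez p q, q%:~R <= Q &
    `|q%:~R * a - p%:~R| * Q <= 1].
Proof.
move=> Q1.
have f0 : 0 < Num.floor Q by rewrite floor_gt0.
have [n /andP[n1 n2]] := cf_den_locate f0.
exists (cf_num a n), (cf_den a n); split.
- exact: cf_den_gt0.
- exact: cf_coprime.
- by apply: le_trans (floor_le Q); rewrite ler_int.
- apply: ltW; apply: le_lt_trans (cf_err_den n); apply: ler_wpM2l => //.
  by rewrite ltW// -floor_lt_int.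
Qed.

(** Given m > 0, take q_n <= 2m < q_(n+1), with error e_n = q_n a - p_n.  If
    m p_n = k q_n, then (m, k) is a multiple of (q_n, p_n) and
    |m| |m a - k| >= q_n |e_n|.  Otherwise
    q_n (m a - k) differs from m e_n by a nonzero integer, while
    m |e_n| <= 1/2, so q_n |m a - k| >= 1/2 and the product is at least 1/4.
    The factor 2 is what makes m |e_n| at most 1/2. *)
Lemma cf_lower_bound (c : R) : c <= 1 / 4 ->
  (forall n, c <= (cf_den a n)%:~R * `|cf_err n|) ->
  forall m k : int, m != 0 -> c <= `|m%:~R| * `|m%:~R * a - k%:~R|.
Proof.
move=> c4 cP.
suff H m k : 0 < m -> c <= `|m%:~R| * `|m%:~R * a - k%:~R|.
  move=> m k m0; case: (ltrgtP m 0) m0 => // mlt _; last exact: H.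
  have := H (- m) (- k); rewrite oppr_gt0 => /(_ mlt).
  by rewrite !rmorphN /= normrN mulNr -opprD normrN.
move=> m0.
have m0R : 0 < m%:~R :> R by rewrite ltr0z.
rewrite (gtr0_norm m0R).
have [n /andP[n1 n2]] := @cf_den_locate (2 * m) ltac:(by rewrite mulr_gt0).
have q0 : 0 < (cf_den a n)%:~R :> R by rewrite ltr0z cf_den_gt0.
have det : (cf_den a n)%:~R * (m%:~R * a - k%:~R) =
  m%:~R * cf_err n + (m * cf_num a n - k * cf_den a n)%:~R.
  by rewrite /cf_err rmorphB !rmorphM /=; ring.
have [z|nz] := eqVneq (m * cf_num a n - k * cf_den a n) 0.
- have /dvdzP[s ms] : (cf_den a n %| m)%Z.
    rewrite -(@Gauss_dvdzl _ _ (cf_num a n)); last first.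
      by rewrite coprimez_sym cf_coprime.
    by apply/dvdzP; exists k; apply/eqP; rewrite -subr_eq0; apply/eqP.
  have ks : m%:~R * a - k%:~R = s%:~R * cf_err n.
    apply: (mulfI (lt0r_neq0 q0)); rewrite det z addr0 [in LHS]ms rmorphM /=; ring.
  have s1 : 1 <= s%:~R :> R.
    have := cf_den_gt0 n; rewrite -[1]/(1%:~R) ler_int.
    by move: m0; rewrite ms => ? ?; nia.
  rewrite ks ms rmorphM /= normrM ger0_norm ?(le_trans _ s1)//.
  apply: (le_trans (cP n)).
  clear z det; move: s1 q0 (normr_ge0 (cf_err n)).
  move: (s%:~R) (cf_den a n)%:~R `|cf_err n| => x y z x1 y0 z0.
  by rewrite mulrACA ler_peMl ?mulr_ge0 ?(ltW y0)//; nra.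
- have d1 : 1 <= `|(m * cf_num a n - k * cf_den a n)%:~R| :> R.
    by rewrite -intr_norm -[1]/(1%:~R) ler_int -gtz0_ge1 normr_gt0.
  have : 1 <= (cf_den a n)%:~R * `|m%:~R * a - k%:~R| + m%:~R * `|cf_err n|.
    apply: le_trans d1 _.
    have -> : (m * cf_num a n - k * cf_den a n)%:~R =
        (cf_den a n)%:~R * (m%:~R * a - k%:~R) - m%:~R * cf_err n.
      by rewrite det; ring.
    apply: le_trans (ler_normB _ _) _.
    by rewrite !normrM (gtr0_norm q0) (gtr0_norm m0R).
  have : m%:~R * `|cf_err n| <= 1 / 2.
    have := cf_err_den n; have : (2 * m)%:~R <= (cf_den a n.+1)%:~R :> R.
      by rewrite ler_int ltW.
    rewrite rmorphM /=; have := normr_ge0 (cf_err n).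
    by move: `|_| m%:~R (cf_den a n.+1)%:~R => x y z x0 h1 h2; nra.
  have : (cf_den a n)%:~R <= 2 * m%:~R :> R.
    by rewrite -[2]/(2%:~R) -intrM ler_int.
  have := normr_ge0 (m%:~R * a - k%:~R).
  move: `|_ - _| (_ * `|_|) (cf_den a n)%:~R => x y z x0 h1 h2 h3.
  apply: le_trans c4 _; nra.
Qed.

End ContinuedFraction.

(** A positive limit inferior bounds the products from below for large indices;
    the finitely many others are positive because a is irrational. *)
Lemma badly_approximableP (R : realType) (a : R) : badly_approximable a ->
  exists2 c, 0 < c &
    forall m k : int, m != 0 -> c <= `|m%:~R| * `|m%:~R * a - k%:~R|.
Proof.
move=> [airr]; set u := (X in limn_einf X) => lim0.
have [N [d d0 dP]] : exists N, exists2 d : R, 0 < d &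
    forall n, (N <= n)%N -> (d%:E <= u n)%E.
  move: lim0; rewrite limn_einf_lim => lim0.
  have : exists N, (0 < einfs u N)%E.
    apply/not_existsP => H; move: lim0; apply/negP; rewrite -leNgt.
    apply: lime_le; first exact: is_cvg_einfs.
    by apply: nearW => n; rewrite leNgt; apply/negP/H.
  move=> [N uN]; exists N.
  have [d d0 dN] : exists2 d : R, 0 < d & (d%:E <= einfs u N)%E.
    case: (einfs u N) uN => [r| |] //; first by rewrite lte_fin => r0; exists r.
    by move=> _; exists 1 => //; rewrite leey.
  exists d => // n Nn; apply: le_trans dN _.
  by apply: ereal_inf_lbound; exists n.
pose w n := (cf_den a n)%:~R * `|cf_err a n|.
have w0 n : 0 < w n.
  by rewrite mulr_gt0 ?ltr0z ?cf_den_gt0// normr_gt0 cf_err_neq0.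
have [e e0 eP] : exists2 e : R, 0 < e & forall n, (n < N)%N -> e <= w n.
  elim: (N) => [|M [e e0 eP]]; first by exists 1.
  exists (Num.min e (w M)); first by rewrite lt_min e0 w0.
  move=> n; rewrite ltnS leq_eqVlt => /predU1P[->|nM].
    by rewrite ge_min lexx orbT.
  by rewrite ge_min eP.
exists (Num.min (1 / 4) (Num.min d e)).
  by rewrite !lt_min d0 e0; lra.
apply: cf_lower_bound => // [|n]; first by rewrite ge_min lexx.
rewrite !ge_min; apply/orP; right; apply/orP.
case: (leqP N n) => nN; last by right; exact: eP.
by left; have := dP n nN; rewrite /u lee_fin.
Qed.

(** * Modulus and argument of complex numbers *)

Local Open Scope complex_scope.

Section ComplexModulus.
Variable R : realType.
Implicit Types (x y z : R[i]) (r s t : R).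

Lemma normcD x y : normc (x + y) <= normc x + normc y.
Proof. exact: le_normcD. Qed.

Lemma normc_opp x : normc (- x) = normc x.
Proof. exact: normcN. Qed.

Lemma normc_ge0 x : 0 <= normc x.
Proof. by case: x => a b; rewrite /normc sqrtr_ge0. Qed.

Lemma normc_distC x y : normc (x - y) = normc (y - x).
Proof. by rewrite -normc_opp opprB. Qed.

Lemma normc_real r : normc r%:C = `|r|.
Proof. by rewrite /normc /= expr0n addr0 sqrtr_sqr. Qed.

(** The reverse triangle inequality. *)
Lemma normc_dist_real x y : `|normc x - normc y| <= normc (x - y).
Proof.
have h1 := normcD (x - y) y; have h2 := normcD (y - x) x.
rewrite !subrK in h1 h2; rewrite (normc_distC y) in h2.
by rewrite ler_norml; apply/andP; split; lra.
Qed.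

Lemma normcD_le x y r s : normc x <= r -> normc y <= s -> normc (x + y) <= r + s.
Proof. by move=> xr ys; apply: le_trans (normcD _ _) _; rewrite lerD. Qed.

Lemma normc_coord r s : [/\ `|r| <= normc (r +i* s), `|s| <= normc (r +i* s) &
  normc (r +i* s) <= `|r| + `|s|].
Proof.
split; rewrite /normc.
- by rewrite -sqrtr_sqr ler_wsqrtr// lerDl sqr_ge0.
- by rewrite -sqrtr_sqr ler_wsqrtr// lerDr sqr_ge0.
- rewrite -[leRHS]ger0_norm ?addr_ge0// -sqrtr_sqr ler_wsqrtr//.
  rewrite -(real_normK (num_real r)) -(real_normK (num_real s)).
  have := normr_ge0 r; have := normr_ge0 s; nra.
Qed.

Definition cis t : R[i] := cos t +i* sin t.

Lemma normc_cis t : normc (cis t) = 1.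
Proof. by rewrite /normc /= cos2Dsin2 sqrtr1. Qed.

Lemma cis0 : cis 0 = 1.
Proof. by rewrite /cis cos0 sin0. Qed.

Lemma cisD s t : cis (s + t) = cis s * cis t.
Proof. by rewrite /cis cosD sinD; simpc; rewrite [_ + sin s * _]addrC. Qed.

Lemma cis_int (k : int) t : cis (t + 2 * pi * k%:~R) = cis t.
Proof.
have H (n : nat) u : cis (u + 2 * pi * n%:R) = cis u.
  have -> : 2 * pi * n%:R = (pi *+ 2) *+ n :> R.
    by rewrite mulr_natr mulr_natl.
  by rewrite /cis (periodicn (@cosD2pi R)) (periodicn (@sinD2pi R)).
case: k => n; first exact: H.
by rewrite NegzE -[LHS](H n.+1) rmorphN mulrN subrK.
Qed.

Lemma sin_lip s t : `|sin s - sin t| <= `|s - t|.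
Proof.
wlog st : s t / t < s.
  move=> H; case: (ltgtP s t) => [st|ts|->]; last by rewrite !subrr.
    by rewrite distrC (distrC s); exact: H.
  exact: H.
have [|c _ ->] := @MVT R sin cos t s st (fun u _ => is_derive_sin u).
- by apply: continuous_subspaceT => x; exact: continuous_sin.
- by rewrite normrM ler_piMl// cos_max.
Qed.

Lemma cos_lip s t : `|cos s - cos t| <= `|s - t|.
Proof.
rewrite -!sinDpihalf; apply: le_trans (sin_lip _ _) _.
by rewrite opprD addrACA subrr addr0.
Qed.

Lemma cis_lip s t : normc (cis s - cis t) <= 2 * `|s - t|.
Proof.
rewrite /cis; simpc.
have [_ _ h] := normc_coord (cos s - cos t) (sin s - sin t).
apply: le_trans h _; rewrite mulr_natl mulr2n lerD//.
  exact: cos_lip.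
exact: sin_lip.
Qed.

(** The constant 1/4 is not sharp: when cos t < 1/2, sin t is at least 1/2 and
    t < 2; otherwise the mean value theorem gives sin t >= t / 2. *)
Lemma sin_lower t : 0 <= t <= pi / 2 -> t / 4 <= sin t.
Proof.
move=> /andP[t0 t1].
have p2 : pi / 2 < 2 :> R := pihalf_lt2 R.
have s0 : 0 <= sin t by apply: sin_ge0_pi; rewrite t0 /=; have := pi_gt0 R; lra.
case: (leP (1/2) (cos t)) => ct; last first.
  have c0 : 0 <= cos t by apply: cos_ge0_pihalf; lra.
  have := cos2Dsin2 t; nra.
case: (ltgtP 0 t) t0 => // [t0 _|<- _]; last by rewrite sin0 mul0r.
have [|c] := @MVT R sin cos 0 t t0 (fun u _ => is_derive_sin u).
- by apply: continuous_subspaceT => x; exact: continuous_sin.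
rewrite in_itv /= sin0 !subr0 => /andP[c0 ct'] ->.
suff : cos t <= cos c by nra.
by apply: ltW; rewrite ltr_cos// in_itv /=; lra.
Qed.

(** The chord from 1 to exp(2 i pi t) has length 2 |sin (pi y)|, where y in
    [-1/2, 1/2] is t minus its nearest integer. *)
Lemma cis_near1 t : exists k : int, `|t - k%:~R| <= normc (cis (2 * pi * t) - 1).
Proof.
pose k := Num.floor (t + 1 / 2); exists k.
have hk : k%:~R <= t + 1 / 2 < k%:~R + 1.
  by rewrite /k floor_le -intrD1 floorD1_gt.
set y := t - k%:~R; have hy : - (1/2) <= y <= 1/2 by rewrite /y; lra.
have -> : cis (2 * pi * t) = cis (2 * pi * y).
  by rewrite -[RHS](cis_int k); congr cis; rewrite /y; ring.
have -> : normc (cis (2 * pi * y) - 1) = 2 * `|sin (pi * y)|.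
  have -> : cis (2 * pi * y) - 1 = cis (pi * y) * (0 +i* (2 * sin (pi * y))).
    have -> : 2 * pi * y = pi * y + pi * y by ring.
    rewrite /cis; simpc; rewrite cosD sinD; apply/eqP; rewrite eq_complex /=.
    have := cos2Dsin2 (pi * y).
    move: (cos _) (sin _) => c s e; by apply/andP; split; apply/eqP; [lra|ring].
  rewrite normcM normc_cis mul1r /normc expr0n add0r sqrtr_sqr normrM.
  by rewrite ger0_norm.
have P0 : 0 < pi / 2 :> R by case/andP: (pihalf_02 R).
have P1 := pihalf_ge1 R.
have H s : 0 <= s <= 1 / 2 -> s <= 2 * sin (pi * s).
  move=> hs; have := @sin_lower (pi * s); nra.
have sE : `|sin (pi * y)| = sin (pi * `|y|).
  have h0 : 0 <= sin (pi * `|y|).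
    have := H `|y|; rewrite normr_ge0 ler_norml.
    by move=> /(_ ltac:(lra)) h; have := normr_ge0 y; lra.
  case: (ler0P y) h0 => hy0 h0; last by rewrite ger0_norm.
  by rewrite -normrN -sinN -mulrN ger0_norm.
by rewrite sE; apply: H; rewrite normr_ge0 ler_norml.
Qed.

Lemma polar_decomp z : exists t, z = (normc z)%:C * cis (2 * pi * t).
Proof.
suff [t zt] : exists t, z = (normc z)%:C * cis t.
  exists (t / (2 * pi)); rewrite (mulrC (2 * pi)) divfK // mulf_neq0 //.
  by rewrite gt_eqF// pi_gt0.
case: z => x y; set r := normc _.
have r0 : 0 <= r := normc_ge0 _.
have rE : r ^+ 2 = x ^+ 2 + y ^+ 2 by rewrite /r /normc sqr_sqrtr// addr_ge0 ?sqr_ge0.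
have [r1|r1] := eqVneq r 0.
  exists 0; have /eqP := rE; rewrite r1 expr0n eq_sym paddr_eq0 ?sqr_ge0//.
  by rewrite !expf_eq0 /= => /andP[/eqP -> /eqP ->]; rewrite mul0r.
have {r0 r1}r0 : 0 < r by rewrite lt_def r1.
have xr : -1 <= x / r <= 1.
  by rewrite ler_pdivlMr// ler_pdivrMr//; have := sqr_ge0 y; nra.
have sy : r * sin (acos (x / r)) = `|y|.
  rewrite sin_acos// -[X in X * _]gtr0_norm// -sqrtr_sqr -sqrtrM ?sqr_ge0//.
  rewrite -sqrtr_sqr; congr Num.sqrt.
  have -> : r ^+ 2 * (1 - (x / r) ^+ 2) = r ^+ 2 - (x / r * r) ^+ 2 by ring.
  by rewrite divfK ?gt_eqF// rE; ring.
have cx : r * cos (acos (x / r)) = x.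
  by rewrite acosK ?in_itv//= mulrC divfK// gt_eqF.
case: (ler0P y) sy => y0 sy.
  exists (- acos (x / r)); rewrite /cis cosN sinN; simpc.
  by rewrite cx sy opprK.
by exists (acos (x / r)); rewrite /cis; simpc; rewrite cx sy.
Qed.

End ComplexModulus.

(** * Geometry of the Fermat spiral *)

Section SpiralGeometry.
Variables (R : realType) (a : R).

Definition spiral (n : nat) : R[i] :=
  (Num.sqrt n%:R)%:C * cis (2 * pi * (a * n%:R)).

Lemma normc_spiral n : normc (spiral n) = Num.sqrt n%:R.
Proof. by rewrite normcM normc_cis mulr1 normc_real ger0_norm ?sqrtr_ge0. Qed.

Lemma sqrt_nat_sqr n : Num.sqrt n%:R ^+ 2 = n%:R :> R.
Proof. by rewrite sqr_sqrtr. Qed.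

(** The rotation taking the direction of the point of index c to that of the
    point of index n. *)
Definition turn (c n : nat) : R[i] := cis (2 * pi * (a * (n%:R - c%:R))).

(** Factoring out the direction of the point of index c lets every comparison
    near that point be made in a frame where it lies on the positive axis. *)
Lemma spiral_turn c n :
  spiral n = cis (2 * pi * (a * c%:R)) * ((Num.sqrt n%:R)%:C * turn c n).
Proof.
rewrite mulrCA -cisD /spiral; congr (_ * cis _); ring.
Qed.

Lemma turn_refl c : turn c c = 1.
Proof. by rewrite /turn subrr !mulr0 cis0. Qed.

Lemma normc_spiralB c n :
  normc (spiral n - spiral c) =
  normc ((Num.sqrt n%:R)%:C * turn c n - (Num.sqrt c%:R)%:C).
Proof.
rewrite (spiral_turn c n) (spiral_turn c c) turn_refl mulr1 -mulrBr normcM.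
by rewrite normc_cis mul1r.
Qed.

(** The radii differ by at most the distance of the points, so after replacing
    one radius by the other only the angular part is left. *)
Lemma turn_bound c n :
  Num.sqrt n%:R * normc (turn c n - 1) <= 2 * normc (spiral n - spiral c).
Proof.
rewrite -[X in X * _]ger0_norm ?sqrtr_ge0// -normc_real -normcM.
have -> : (Num.sqrt n%:R)%:C * (turn c n - 1) =
  ((Num.sqrt n%:R)%:C * turn c n - (Num.sqrt c%:R)%:C) +
  ((Num.sqrt c%:R)%:C - (Num.sqrt n%:R)%:C) by ring.
rewrite mulr_natl mulr2n; apply: normcD_le; first by rewrite -normc_spiralB.
rewrite -rmorphB normc_real -!normc_spiral distrC.
exact: normc_dist_real.
Qed.

Lemma normc_turn_sym c n : normc (turn c n - 1) = normc (turn n c - 1).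
Proof.
have e : turn c n * turn n c = 1.
  by rewrite /turn -cisD -[RHS](@cis0 R); congr cis; ring.
have -> : turn n c - 1 = - turn n c * (turn c n - 1).
  by rewrite mulrBr mulr1 mulNr (mulrC (turn n c)) e opprK addrC.
by rewrite normcM normc_opp normc_cis mul1r.
Qed.

(** Let h be the distance of the points, r and s their radii and w the chord of
    the turn between them.  Then |n - m| = |r - s| (r + s) <= h (r + s) and
    (r + s) w <= 4 h, while w bounds the distance of a (n - m) to the integers;
    multiplying, c <= 4 h^2. *)
Lemma spiral_separated (c : R) (m n : nat) :
  (forall m k : int, m != 0 -> c <= `|m%:~R| * `|m%:~R * a - k%:~R|) ->
  m != n -> c <= 4 * normc (spiral n - spiral m) ^+ 2.
Proof.
move=> cP mn; set h := normc _.
have h0 : 0 <= h := normc_ge0 _.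
have [k kP] := cis_near1 (a * (n%:R - m%:R)).
have t1 := turn_bound m n; have t2 := turn_bound n m.
rewrite (normc_distC (spiral m)) -/h in t2; rewrite -/h in t1.
rewrite -normc_turn_sym in t2; set w := normc _ in t1 t2.
have kw : `|(n%:R - m%:R) * a - k%:~R| <= w by rewrite [_ * a]mulrC.
have dr := normc_dist_real (spiral n) (spiral m).
rewrite -/h !normc_spiral in dr.
have E : n%:R - m%:R = (n%:Z - m%:Z)%:~R :> R by rewrite rmorphB.
have := cP (n%:Z - m%:Z) k; rewrite -E => /(_ ltac:(lia)) Hc.
apply: (le_trans Hc).
have rn := sqrtr_ge0 (n%:R : R); have rm := sqrtr_ge0 (m%:R : R).
have w0 : 0 <= w := normc_ge0 _.
have -> : `|n%:R - m%:R| = `|Num.sqrt n%:R - Num.sqrt m%:R|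
    * (Num.sqrt n%:R + Num.sqrt m%:R) :> R.
  rewrite -[X in _ * X]ger0_norm ?addr_ge0// -normrM.
  by rewrite -subr_sqr !sqrt_nat_sqr.
have := normr_ge0 ((n%:R - m%:R) * a - k%:~R).
have := normr_ge0 (Num.sqrt n%:R - Num.sqrt m%:R : R).
move: dr kw rn rm t1 t2 h0 w0; rewrite {Hc cP kP E}.
move: (Num.sqrt _) (Num.sqrt _) w h `|_ * a - _| `|_ - Num.sqrt m%:R|.
move=> s r {}w {}h y x xh yw r0 s0 rw sw h0 w0 x0 y0.
have h1 : x * (r + s) * y <= h * (r + s) * w.
  rewrite -!mulrA ler_pM ?mulr_ge0 ?addr_ge0// ler_pM ?addr_ge0//.
apply: le_trans h1 _; nra.
Qed.

(** As m runs through a full residue system modulo q, m p / q meets every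
    multiple of 1 / q modulo 1. *)
Lemma coprime_residue (p q : int) (y : R) : 0 < q -> coprimez p q ->
  exists (m : nat) (k : int), m%:Z < q /\
    `|m%:R * (p%:~R / q%:~R) - y - k%:~R| <= 1 / q%:~R.
Proof.
move=> q0 /coprimezP[[u v] /= uv].
pose j := Num.floor (q%:~R * y); pose mz := ((u * j) %% q)%Z.
have mz0 : 0 <= mz by rewrite modz_ge0// gt_eqF.
have mzq : mz < q by rewrite ltz_pmod.
have [k kE] : exists k, mz * p - j = q * k.
  exists (- ((u * j) %/ q)%Z * p - v * j).
  have := divz_eq (u * j) q; rewrite -/mz => e.
  have -> : mz = u * j - ((u * j) %/ q)%Z * q.
    by rewrite [X in X - _]e addrAC subrr add0r.
  transitivity
    ((u * p + v * q) * j - j - ((u * j) %/ q)%Z * q * p - q * v * j).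
    by ring.
  by rewrite uv; ring.
move: mz mz0 mzq kE => mz mz0 mzq kE.
exists `|mz|%N, k; rewrite pmulrn gez0_abs//; split=> //.
have qR : 0 < q%:~R :> R by rewrite ltr0z.
have -> : mz%:~R * (p%:~R / q%:~R) - y - k%:~R = (j%:~R - q%:~R * y) / q%:~R.
  apply: (mulIf (lt0r_neq0 qR)); rewrite divfK ?gt_eqF//.
  have -> : j = mz * p - q * k by rewrite -kE; ring.
  by rewrite rmorphB !rmorphM /= -[in RHS](divfK (lt0r_neq0 qR) p%:~R); ring.
rewrite normrM (gtr0_norm (x := q%:~R^-1)) ?invr_gt0//.
rewrite ler_pM2r ?invr_gt0// ler_norml.
have : j%:~R <= q%:~R * y < j%:~R + 1 by rewrite /j floor_le -intrD1 floorD1_gt.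
lra.
Qed.

(** Let z have modulus r and argument 2 pi b, and put Q = r + 1.  Dirichlet
    gives a fraction p / q with q <= Q, and bad approximability forces
    q >= c Q.  Among the q consecutive indices from the integer part of r^2
    on, whose radii stay within 2 of r, some n has a n within 2 / (c Q) of b
    modulo 1, so that the point of index n is at distance O(1) from z. *)
Lemma spiral_relatively_dense : badly_approximable a ->
  exists2 rho : R, 0 < rho & forall z : R[i], exists n, normc (spiral n - z) <= rho.
Proof.
move=> abad; have airr := abad.1; have [c c0 cP] := badly_approximableP abad.
(* 2 for the radius and 32 = 2 * (2 pi bounded by 8) * 2 for the angle. *)
exists (2 + 32 / c); first by rewrite addr_gt0// divr_gt0.
move=> z; have [b zE] := polar_decomp z; set r := normc z in zE.
have r0 : 0 <= r := normc_ge0 z.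
pose Q := r + 1; have Q1 : 1 <= Q by rewrite /Q; lra.
have [p [q [q0 pq qQ pQ]]] := cf_dirichlet airr Q1.
have qR : 0 < q%:~R :> R by rewrite ltr0z.
pose N := Num.truncn (r ^+ 2).
have [N1 N2] : N%:R <= r ^+ 2 /\ r ^+ 2 < N%:R + 1.
  have := truncn_itv (sqr_ge0 r); rewrite -/N -natr1.
  by case/andP.
have [m [k [mq mP]]] := coprime_residue (b - a * N%:R) q0 pq.
have mqR : m%:R <= q%:~R :> R by rewrite pmulrn ler_int ltW.
exists (N + m)%N; set n := (N + m)%N.
have nN : n%:R = N%:R + m%:R :> R by rewrite natrD.
have angle : `|a * n%:R - b - k%:~R| <= 2 / (c * Q).
  have e : a * n%:R - b - k%:~R = m%:R * ((q%:~R * a - p%:~R) / q%:~R) +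
     (m%:R * (p%:~R / q%:~R) - (b - a * N%:R) - k%:~R).
    rewrite nN mulrBl (mulrC q%:~R) mulfK ?gt_eqF//; ring.
  have cq : c * Q <= q%:~R.
    have := cP q p; rewrite gt_eqF// gtr0_norm// => /(_ isT).
    have := normr_ge0 (q%:~R * a - p%:~R); move: pQ; move: `|_| => x *.
    apply: le_trans (_ : q%:~R * x * Q <= _); nra.
  have cQ0 : 0 < c * Q by rewrite mulr_gt0//; lra.
  have iq : 1 / q%:~R <= 1 / (c * Q).
    by rewrite !div1r lef_pV2 ?posrE.
  rewrite e; apply: le_trans (ler_normD _ _) _.
  suff : `|m%:R * ((q%:~R * a - p%:~R) / q%:~R)| <= 1 / q%:~R.
    move=> hB; have -> : 2 / (c * Q) = 1 / (c * Q) + 1 / (c * Q) by ring.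
    lra.
  rewrite !normrM (gtr0_norm (x := q%:~R^-1)) ?invr_gt0// mulrA.
  rewrite ler_pM2r ?invr_gt0// ger0_norm//.
  have := normr_ge0 (q%:~R * a - p%:~R); move: pQ; move: `|_| => x x1 x0.
  by have := ler0n R m; nra.
have radius : `|Num.sqrt n%:R - r| <= 2.
  have s0 := sqrtr_ge0 (n%:R : R); have s2 := sqrt_nat_sqr n.
  have m0 := ler0n R m; have rq : m%:R <= r + 1 by apply: le_trans mqR _.
  move: s0 s2; rewrite nN; move: (Num.sqrt _) => s s0 s2.
  have u1 : s <= r + 2 by rewrite -(ler_pXn2r (n := 2)) ?nnegrE//; nra.
  have u2 : r - 2 <= s.
    case: (leP r 2) => r2; first by lra.
    by rewrite -(ler_pXn2r (n := 2)) ?nnegrE//; nra.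
  by rewrite ler_norml; lra.
have -> : spiral n - z = ((Num.sqrt n%:R)%:C - r%:C) * cis (2 * pi * (a * n%:R))
    + r%:C * (cis (2 * pi * (a * n%:R)) - cis (2 * pi * b)).
  rewrite zE /spiral; ring.
apply: normcD_le.
  by rewrite normcM normc_cis mulr1 -rmorphB normc_real.
rewrite normcM normc_real ger0_norm// -[cis (2 * pi * b)](cis_int k).
apply: le_trans (ler_wpM2l r0 (cis_lip _ _)) _.
have -> : 2 * pi * (a * n%:R) - (2 * pi * b + 2 * pi * k%:~R) =
  2 * pi * (a * n%:R - b - k%:~R) by ring.
have p0 := pi_gt0 R; have p4 : pi <= 4 :> R by have := pihalf_lt2 R; lra.
rewrite normrM (gtr0_norm (x := 2 * pi)) ?mulr_gt0//.
have cQ0 : 0 < c * Q by rewrite mulr_gt0//; lra.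
move: angle; rewrite ler_pdivlMr// ler_pdivlMr//.
have := normr_ge0 (a * n%:R - b - k%:~R); move: `|_| => x x0 hx.
apply: le_trans (_ : 2 * (2 * 4) * (x * (c * Q)) <= _); last by lra.
rewrite /Q; have : pi * (r * x * c) <= 4 * (r * x * c).
  by rewrite ler_wpM2r// !mulr_ge0// ltW.
have : 0 <= x * c by rewrite mulr_ge0// ltW.
nra.
Qed.

(** With radii rd^2 = ri^2 + rj^2 - rc^2 and turns u, w from x_c to x_i, x_j,
    the error is, up to a rotation,
      rd (u - 1) (w - 1) + (rd - ri) (u - 1) + (rd - rj) (w - 1)
        + (rd - ri - rj + rc).
    Here |u - 1| and |w - 1| are O(rho / rc), the first differences of radii are
    O(rho), and the second difference is O(rho^2 / rc), so each term is
    O(rho^2 / rc). *)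
Lemma spiral_parallelogram (rho : R) (i j c : nat) :
  4 * rho <= Num.sqrt c%:R -> 0 < Num.sqrt c%:R :> R ->
  normc (spiral i - spiral c) <= rho ->
  normc (spiral j - spiral c) <= rho ->
  Num.sqrt c%:R *
    normc (spiral (i + j - c) - (spiral i + spiral j - spiral c)) <= 40 * rho ^+ 2.
Proof.
move=> rhoc rc0 hi hj.
have bi := turn_bound c i; have bj := turn_bound c j.
have di := normc_dist_real (spiral i) (spiral c).
have dj := normc_dist_real (spiral j) (spiral c).
rewrite !normc_spiral in di dj.
have {}di : `|Num.sqrt i%:R - Num.sqrt c%:R| <= rho by lra.
have {}dj : `|Num.sqrt j%:R - Num.sqrt c%:R| <= rho by lra.
have si := sqrt_nat_sqr i; have sj := sqrt_nat_sqr j; have sc := sqrt_nat_sqr c.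
move: (di) (dj); rewrite !ler_norml => /andP[di1 di2] /andP[dj1 dj2].
have cij : (c <= i + j)%N.
  by rewrite -(ler_nat R) natrD -si -sj -sc; nra.
set d := (i + j - c)%N.
have dE : d%:R = i%:R + j%:R - c%:R :> R by rewrite natrB// natrD.
have sd : Num.sqrt d%:R ^+ 2 = Num.sqrt i%:R ^+ 2 + Num.sqrt j%:R ^+ 2
  - Num.sqrt c%:R ^+ 2 :> R by rewrite !sqrt_nat_sqr.
have rd0 := sqrtr_ge0 (d%:R : R).
have td : turn c d = turn c i * turn c j.
  by rewrite /turn -cisD dE; congr cis; ring.
rewrite (spiral_turn c d) (spiral_turn c i) (spiral_turn c j).
rewrite (spiral_turn c c) turn_refl mulr1 td.
rewrite -mulrDr -mulrBr -mulrBr normcM normc_cis mul1r.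
move: bi bj rd0 sd di dj di1 di2 dj1 dj2 rhoc rc0; rewrite {si sj sc dE td cij}.
set u := turn c i; set w := turn c j.
have u0 := normc_ge0 (u - 1); have w0 := normc_ge0 (w - 1).
move: (Num.sqrt d%:R) (Num.sqrt i%:R) (Num.sqrt j%:R) (Num.sqrt c%:R).
move=> rd ri rj rc bi bj rd0 sd di dj di1 di2 dj1 dj2 rhoc rc0.
have -> : rd%:C * (u * w) - (ri%:C * u + rj%:C * w - rc%:C) =
  (rd%:C * (u - 1) * (w - 1) + ((rd - ri)%:C * (u - 1) + (rd - rj)%:C * (w - 1)))
    + (rd - ri - (rj - rc))%:C.
  rewrite !rmorphB /=; ring.
have rho0 : 0 <= rho by lra.
have {bi}bi : rc * normc (u - 1) <= 3 * rho by nra.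
have {bj}bj : rc * normc (w - 1) <= 3 * rho by nra.
have ri1 : 3 / 4 * rc <= ri by lra.
have rj1 : 3 / 4 * rc <= rj by lra.
have ri2 : ri ^+ 2 <= 25 / 16 * rc ^+ 2 by nra.
have rj2 : rj ^+ 2 <= 25 / 16 * rc ^+ 2 by nra.
have rdc : rd <= 3 / 2 * rc.
  rewrite -(ler_pXn2r (n := 2)) ?nnegrE//; last by lra.
  by rewrite sd exprMn; have := sqr_ge0 rc; lra.
have edi : (rd - ri) * (rd + ri) = (rj - rc) * (rj + rc).
  by rewrite -!subr_sqr sd; ring.
have edj : (rd - rj) * (rd + rj) = (ri - rc) * (ri + rc).
  by rewrite -!subr_sqr sd; ring.
have H (x y z : R) : 3 / 4 * rc <= x -> `|y| * x <= z -> 3 / 4 * rc * `|y| <= z.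
  by move=> xrc; apply: le_trans; rewrite mulrC ler_wpM2l.
have Di : `|rd - ri| <= 3 * rho.
  suff : 3 / 4 * rc * `|rd - ri| <= rho * (9 / 4 * rc).
    by move: `|rd - ri| => x; nra.
  apply: (H (rd + ri)); first by lra.
  rewrite -[X in _ * X <= _]ger0_norm; last by lra.
  rewrite -normrM edi normrM ler_pM// ger0_norm; lra.
have Dj : `|rd - rj| <= 3 * rho.
  suff : 3 / 4 * rc * `|rd - rj| <= rho * (9 / 4 * rc).
    by move: `|rd - rj| => x; nra.
  apply: (H (rd + rj)); first by lra.
  rewrite -[X in _ * X <= _]ger0_norm; last by lra.
  rewrite -normrM edj normrM ler_pM// ger0_norm; lra.
have De : 3 / 4 * rc * `|rd - ri - (rj - rc)| <= rho * (4 * rho).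
  apply: (H (rd + ri)); first by lra.
  rewrite -[X in _ * X <= _]ger0_norm; last by lra.
  have e : (rd - ri - (rj - rc)) * (rd + ri) =
      (rj - rc) * (rc - ri - (rd - rj)) by rewrite mulrBl edi; ring.
  rewrite -normrM e normrM ler_pM//; apply: le_trans (ler_normB _ _) _.
  by rewrite (distrC rc); lra.
have tri (x y z t : R[i]) :
    normc (x + (y + z) + t) <= normc x + (normc y + normc z) + normc t.
  apply: normcD_le => //; apply: normcD_le => //; exact: normcD.
apply: le_trans (ler_wpM2l (ltW rc0) (tri _ _ _ _)) _.
rewrite !normcM !normc_real (ger0_norm rd0).
move: Di Dj De bi bj u0 w0.
have := normr_ge0 (rd - ri); have := normr_ge0 (rd - rj).
move: (normc (u - 1)) (normc (w - 1)) `|rd - ri - (rj - rc)| `|rd - ri| `|rd - rj|.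
move=> U W E A B B0 A0 hA hB hE hU hW U0 W0.
have t1 : rc * (rd * U * W) <= 3 / 2 * ((3 * rho) * (3 * rho)).
  apply: le_trans (_ : 3 / 2 * ((rc * U) * (rc * W)) <= _); last first.
    rewrite ler_wpM2l// ler_pM// mulr_ge0// ltW//.
  have : 0 <= rc * U * W by rewrite !mulr_ge0// ltW.
  nra.
have t2 : rc * (A * U) <= 3 * rho * (3 * rho).
  by rewrite mulrCA ler_pM// mulr_ge0// ltW.
have t3 : rc * (B * W) <= 3 * rho * (3 * rho).
  by rewrite mulrCA ler_pM// mulr_ge0// ltW.
nra.
Qed.

End SpiralGeometry.

(** * Chabauty limits of the spiral *)

Section Plane.
Variable R : realType.
Implicit Types (x y : 'rV[R]_2).

(** The plane is identified with the complex numbers, whose modulus is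
    multiplicative. *)
Definition toC x : R[i] := x 0 0 +i* x 0 1.

Lemma toCD x y : toC (x + y) = toC x + toC y.
Proof. by rewrite /toC !mxE; simpc. Qed.

Lemma toCN x : toC (- x) = - toC x.
Proof. by rewrite /toC !mxE; simpc. Qed.

Lemma toCB x y : toC (x - y) = toC x - toC y.
Proof. by rewrite toCD toCN. Qed.

Lemma enorm_toC x : enorm x = normc (toC x).
Proof.
rewrite /enorm big_ord_recr /= big_ord1 /normc /toC /=; do 2 f_equal.
  by congr (x _ _ ^+ 2); apply/val_inj.
by congr (x _ _ ^+ 2); apply/val_inj.
Qed.

Lemma toC_polar r t : toC (polar r t) = r%:C * cis t.
Proof. by rewrite /toC /cis !mxE /=; simpc. Qed.

Definition ofC (z : R[i]) : 'rV[R]_2 :=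
  \row_(i < 2) (if i == 0 then complex.Re z else complex.Im z).

Lemma ofCK z : toC (ofC z) = z.
Proof. by case: z => u v; rewrite /toC !mxE. Qed.

Lemma enorm_eq0 x : enorm x = 0 -> x = 0.
Proof.
rewrite enorm_toC => /eq0_normc [x0 x1]; apply/rowP => i; rewrite mxE.
by case: i => -[|[|//]] h; [rewrite -[RHS]x0|rewrite -[RHS]x1];
  congr (x _ _); apply/val_inj.
Qed.

Lemma enorm_coord x : [/\ `|x 0 0| <= enorm x, `|x 0 1| <= enorm x &
  enorm x <= `|x 0 0| + `|x 0 1|].
Proof. by rewrite enorm_toC; exact: normc_coord. Qed.

Lemma ball_coord x (e : R) y : 0 < e -> ball x e y <->
  `|y 0 0 - x 0 0| < e /\ `|y 0 1 - x 0 1| < e.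
Proof.
move=> e0; split=> [[_ h]|[h0 h1]].
  by split; rewrite distrC; have := h 0; [move/(_ 0)|move/(_ 1)].
split=> // i j; rewrite (ord1 i) /ball /= distrC.
case: j => -[|[|//]] h; [move: h0|move: h1];
  by congr (`|y _ _ - x _ _| < _); apply/val_inj.
Qed.

Lemma closed_enorm (Y : set 'rV[R]_2) x : closed Y ->
  (forall e, 0 < e -> exists2 y, Y y & enorm (y - x) < e) -> Y x.
Proof.
move=> Ycl h; apply: Ycl => U /nbhs_ballP[e /= e0 eU].
have [y Yy yx] := h e e0; exists y; split=> //; apply: eU; apply/ball_coord => //.
have [h0 h1 _] := enorm_coord (y - x).
by move: h0 h1; rewrite !mxE => h0 h1; split; apply: le_lt_trans yx.
Qed.

End Plane.

(** Both inclusions weaken as e grows, so any e above the infimum satisfies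
    them; for e <= 1 a distance below e is not a truncated one. *)
Lemma chabauty_dist_lt (R : realType) (d : nat) (A B : set 'rV[R]_d) (e : R) :
  0 < e -> e <= 1 -> chabauty_dist A B < e ->
  eball 0 e^-1 `&` A `<=` nbhd e B /\ eball 0 e^-1 `&` B `<=` nbhd e A.
Proof.
move=> e0 e1 dAB.
have : (chabauty_Delta A B < e%:E)%E.
  move: dAB; rewrite /chabauty_dist /Order.min.
  case: ifP => [_ /=|]; first by rewrite ltNge e1.
  case: (chabauty_Delta A B) => [r _| |_ _] /=; last by rewrite ltNye.
    by rewrite lte_fin.
  by rewrite ltry.
move=> /ereal_inf_lt[_ [e' /= [e'0 AB BA] <-]]; rewrite lte_fin => ee.
have bS : eball (0 : 'rV[R]_d) e^-1 `<=` eball 0 e'^-1.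
  by move=> x /lt_le_trans; apply; rewrite lef_pV2 ?posrE// ltW.
have nS (C : set 'rV[R]_d) : nbhd e' C `<=` nbhd e C.
  by move=> x [y Cy yx]; exists y => //; apply: lt_trans yx ee.
split=> x [/bS bx Ax]; apply: nS; [exact: AB|exact: BA].
Qed.

Section Limit.
Variables (R : realType) (a : R) (Y : set 'rV[R]_2).

Lemma mem_fermat_spiral x : fermat_spiral a x <-> exists n, toC x = spiral a n.
Proof.
split=> [[n _ <-]|[n xn]].
  by exists n; rewrite toC_polar /spiral mulrA.
exists n => //; apply/eqP; rewrite -subr_eq0; apply/eqP.
apply: enorm_eq0; rewrite enorm_toC toCB toC_polar xn /spiral mulrA subrr.
exact: normc0.
Qed.

(** The only consequence of Chabauty convergence that the proof uses: on discs
    of any radius M, a translate of the spiral by some V of modulus at least M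
    approximates Y up to e, in both directions.  A single translate suffices for
    each argument below. *)
Definition approximable := forall M e : R, 0 < M -> 0 < e -> exists V : R[i],
  [/\ M <= normc V,
      forall y, Y y -> normc (toC y) < M ->
        exists n, normc (spiral a n + V - toC y) < e &
      forall n, normc (spiral a n + V) < M ->
        exists2 y, Y y & normc (spiral a n + V - toC y) < e].

Lemma chabauty_limit_approximable :
  chabauty_limit (fermat_spiral a) Y -> approximable.
Proof.
move=> [_ [v [voo vY]]] M e M0 e0.
pose e' := Num.min 1 (Num.min e M^-1).
have e'0 : 0 < e' by rewrite !lt_min ltr01 e0 invr_gt0.
have e'1 : e' <= 1 by rewrite ge_min lexx.
have e'e : e' <= e by rewrite !ge_min lexx !orbT.
have Me : M <= e'^-1.
  by rewrite -[M]invrK lef_pV2 ?posrE ?invr_gt0// !ge_min lexx !orbT.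
have [n [vn dn]] : exists n, M <= enorm (v n) /\
    chabauty_dist (translate (v n) (fermat_spiral a)) Y < e'.
  have h1 : \forall n \near \oo, M <= enorm (v n).
    by move/cvgryPge : voo; exact.
  have h2 : \forall n \near \oo,
      chabauty_dist (translate (v n) (fermat_spiral a)) Y < e'.
    have /cvgr_lt := vY; exact.
  near \oo => n; exists n; split; near: n; [exact: h1|exact: h2].
have [AB BA] := chabauty_dist_lt e'0 e'1 dn.
exists (toC (v n)); split; first by rewrite -enorm_toC.
- move=> y Yy yM.
  have [|x [x' /mem_fermat_spiral[k xk] <-] yx] := BA y.
    by split=> //; rewrite /eball /= subr0 enorm_toC (lt_le_trans yM).
  exists k; rewrite -xk -toCD normc_distC -toCB -enorm_toC.
  exact: lt_le_trans yx e'e.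
- move=> k kM; pose x := ofC (spiral a k).
  have [|y Yy yx] := AB (x + v n).
    split; last by exists x => //; apply/mem_fermat_spiral; exists k; rewrite ofCK.
    by rewrite /eball /= subr0 enorm_toC toCD ofCK (lt_le_trans kM).
  exists y => //; rewrite -(ofCK (spiral a k)) -toCD -toCB -enorm_toC.
  exact: lt_le_trans yx e'e.
Unshelve. all: by end_near. Qed.

Hypothesis Yapp : approximable.

(** Two points of Y at distance D below the separation s of the spiral are
    approximated by the same spiral point, as soon as the error is below
    (s - D) / 2; if also below D / 2, this contradicts D > 0. *)
Lemma limit_separated (c : R) : 0 < c ->
  (forall m k : int, m != 0 -> c <= `|m%:~R| * `|m%:~R * a - k%:~R|) ->
  exists2 s : R, 0 < s &
    forall y y', Y y -> Y y' -> enorm (y - y') < s -> y = y'.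
Proof.
move=> c0 cP; exists (Num.sqrt c / 2); first by rewrite divr_gt0// sqrtr_gt0.
move=> y y' Yy Yy' yy'; apply/eqP; rewrite -subr_eq0; apply/eqP/enorm_eq0.
apply/eqP; rewrite eq_le; apply/andP; split; last first.
  by rewrite enorm_toC normc_ge0.
rewrite leNgt; apply/negP => D0.
move: D0 yy'; rewrite enorm_toC toCB; set D := normc _ => D0 yy'.
set s := Num.sqrt c / 2 in yy'.
pose e := Num.min (D / 2) ((s - D) / 2).
have e0 : 0 < e by rewrite lt_min; lra.
have [e1 e2] : e <= D / 2 /\ e <= (s - D) / 2.
  by split; rewrite ge_min lexx ?orbT.
have n0 := normc_ge0 (toC y); have n0' := normc_ge0 (toC y').
have [|V [_ hV _]] := @Yapp (normc (toC y) + normc (toC y') + 1) e _ e0.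
  by lra.
have [|i yi] := hV y Yy; first by lra.
have [|j yj] := hV y' Yy'; first by lra.
have [ij|ij] := eqVneq i j.
  subst j.
  have : D <= normc (spiral a i + V - toC y') + normc (spiral a i + V - toC y).
    have -> : D = normc ((spiral a i + V - toC y') - (spiral a i + V - toC y)).
      by congr normc; ring.
    by apply: le_trans (normcD _ _) _; rewrite normc_opp.
  by lra.
have := spiral_separated cP ij.
have : normc (spiral a j - spiral a i) < s.
  have -> : spiral a j - spiral a i = (spiral a j + V - toC y') +
    (- (spiral a i + V - toC y) - (toC y - toC y')) by ring.
  apply: le_lt_trans (normcD _ _) _.
  have := normcD (- (spiral a i + V - toC y)) (- (toC y - toC y')).
  by rewrite !normc_opp -/D; lra.
have := normc_ge0 (spiral a j - spiral a i).
have : c = 4 * s ^+ 2 by rewrite /s expr_div_n sqr_sqrtr ?ltW//; field.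
by nra.
Qed.

Lemma limit_relatively_dense (rho : R) : 0 < rho ->
  (forall z : R[i], exists n, normc (spiral a n - z) <= rho) ->
  forall z, exists2 y, Y y & normc (toC y - z) <= rho + 1.
Proof.
move=> rho0 rhoP z; have z0 := normc_ge0 z.
have [|V [_ _ hV]] := @Yapp (normc z + rho + 1) 1 _ ltr01; first by lra.
have [n nz] := rhoP (z - V).
have e : spiral a n - (z - V) = spiral a n + V - z by ring.
rewrite e in nz.
have [|y Yy yn] := hV n.
  by have := normcD (spiral a n + V - z) z; rewrite subrK; lra.
exists y => //.
have -> : toC y - z = (spiral a n + V - z) - (spiral a n + V - toC y) by ring.
by apply: normcD_le => //; rewrite normc_opp ltW.
Qed.

(** The spiral points i, j, c approximating x, y, z have large modulus, since V
    does, so the point i + j - c approximates x + y - z, and it is in turn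
    approximated by a point of Y. *)
Lemma limit_parallelogram : closed Y ->
  forall x y z, Y x -> Y y -> Y z -> Y (x + y - z).
Proof.
move=> Ycl x y z Yx Yy Yz; apply: closed_enorm => // h h0.
have nx := normc_ge0 (toC x); have ny := normc_ge0 (toC y).
have nz := normc_ge0 (toC z).
pose B := normc (toC x) + normc (toC y) + normc (toC z) + 1.
have B1 : 1 <= B by rewrite /B; lra.
(* 2 B bounds the distances between the approximating points; since
   sqrt c >= M - B, the term 320 (2 B)^2 / h brings the parallelogram error
   40 (2 B)^2 / sqrt c below h / 8. *)
pose M := B + 4 * (2 * B) + 1 + h + 320 * (2 * B) ^+ 2 / h.
have F0 : 0 <= 320 * (2 * B) ^+ 2 / h.
  exact: divr_ge0 (mulr_ge0 (ler0n _ _) (sqr_ge0 _)) (ltW h0).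
have M1 : B < M by rewrite /M; lra.
pose e := Num.min (1 / 2) (h / 8).
have e0 : 0 < e by rewrite lt_min; lra.
have [e1 e2] : e <= 1 / 2 /\ e <= h / 8.
  by split; rewrite ge_min lexx ?orbT.
have [|V [VM hV hV']] := @Yapp M e _ e0; first by lra.
have [|i xi] := hV x Yx; first by apply: le_lt_trans M1; rewrite /B; lra.
have [|j yj] := hV y Yy; first by apply: le_lt_trans M1; rewrite /B; lra.
have [|c zc] := hV z Yz; first by apply: le_lt_trans M1; rewrite /B; lra.
have rc : M - B <= Num.sqrt c%:R.
  rewrite -(normc_spiral a).
  have : normc V <= normc (spiral a c + V - toC z) +
      (normc (spiral a c) + normc (toC z)).
    have {1}-> : V = (spiral a c + V - toC z) + (- spiral a c + toC z) by ring.
    apply: normcD_le => //; apply: le_trans (normcD _ _) _.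
    by rewrite normc_opp.
  by rewrite /B; lra.
have near2 u k : normc (spiral a k + V - toC u) < e ->
    normc (toC u) + normc (toC z) + 1 <= B ->
    normc (spiral a k - spiral a c) <= 2 * B.
  move=> uk uB.
  have -> : spiral a k - spiral a c = (spiral a k + V - toC u) +
      (- (spiral a c + V - toC z) + (toC u - toC z)) by ring.
  apply: le_trans (normcD _ _) _.
  have := normcD (- (spiral a c + V - toC z)) (toC u - toC z).
  have := normcD (toC u) (- toC z).
  by rewrite !normc_opp; lra.
have ic := near2 _ _ xi ltac:(by rewrite /B; lra).
have jc := near2 _ _ yj ltac:(by rewrite /B; lra).
have h4 : 4 * (2 * B) <= Num.sqrt c%:R by apply: le_trans rc; rewrite /M; lra.
have := spiral_parallelogram h4 ltac:(lra) ic jc.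
set d := (i + j - c)%N => hd.
have {hd}hd : normc (spiral a d - (spiral a i + spiral a j - spiral a c)) <= h / 8.
  have h5 : 320 * (2 * B) ^+ 2 / h <= Num.sqrt c%:R.
    by apply: le_trans rc; rewrite /M; lra.
  rewrite ler_pdivrMr// in h5; move: h5 hd.
  have s0 : 0 < Num.sqrt c%:R :> R by lra.
  move=> h5 hd; rewrite -(ler_pM2l s0); apply: le_trans hd _; lra.
have pd : normc (spiral a d + V - toC (x + y - z)) <= h / 2.
  rewrite toCB toCD.
  have -> : spiral a d + V - (toC x + toC y - toC z) =
    (spiral a d - (spiral a i + spiral a j - spiral a c)) +
    ((spiral a i + V - toC x) + ((spiral a j + V - toC y)
      - (spiral a c + V - toC z))) by ring.
  have -> : h / 2 = h / 8 + (h / 8 + (h / 8 + h / 8)) by field.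
  do 3 (apply: normcD_le; first by lra).
  by rewrite normc_opp; lra.
have [|w Yw wd] := hV' d.
  have -> : spiral a d + V = (spiral a d + V - toC (x + y - z)) +
      ((toC x + toC y) - toC z) by rewrite toCB toCD; ring.
  apply: le_lt_trans (normcD _ _) _.
  have := normcD (toC x + toC y) (- toC z); have := normcD (toC x) (toC y).
  rewrite normc_opp => u1 u2; apply: le_lt_trans (_ : h / 2 + B < _).
    by rewrite /B; lra.
  by rewrite /M; lra.
exists w => //; rewrite enorm_toC toCB.
have -> : toC w - toC (x + y - z) = (spiral a d + V - toC (x + y - z)) -
    (spiral a d + V - toC w) by ring.
by apply: le_lt_trans (normcD _ _) _; rewrite normc_opp; lra.
Qed.

End Limit.

(** * Discrete relatively dense subgroups of the plane *)

Section DiscreteGroup.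
Variables (R : realType) (L : set 'rV[R]_2).
Hypothesis L_group : zmod_closed [in L].

Lemma group_mem0 : L 0.
Proof. by have [/set_mem] := L_group. Qed.

Lemma group_memB x y : L x -> L y -> L (x - y).
Proof.
by move=> Lx Ly; have [_ h] := L_group; apply/set_mem/h; exact/mem_set.
Qed.

Lemma group_memD x y : L x -> L y -> L (x + y).
Proof.
move=> Lx Ly; rewrite -[y]opprK; apply: group_memB => //.
by rewrite -sub0r; apply: group_memB => //; exact: group_mem0.
Qed.

Lemma group_mem_sum n (u : 'I_n -> 'rV[R]_2) (c : 'I_n -> nat) :
  (forall i, L (u i)) -> L (\sum_i u i *+ c i).
Proof.
move=> Lu; apply: (big_ind L); [exact: group_mem0|exact: group_memD|].
move=> i _; elim: (c i) => [|k IH]; first exact: group_mem0.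
by rewrite mulrS; exact: group_memD.
Qed.

Variable s : R.
Hypothesis s0 : 0 < s.
Hypothesis L_separated : forall x, L x -> enorm x < s -> x = 0.

Lemma separated_isolated : L `<=` isolated L.
Proof.
move=> x Lx; split; first exact/mem_set.
have s2 : 0 < s / 2 by rewrite divr_gt0.
exists (ball x (s / 2)); first exact: nbhsx_ballx.
apply/seteqP; split=> [y [/(ball_coord _ _ s2)[h0 h1] Ly]|_ -> /=].
  apply/eqP; rewrite -subr_eq0; apply/eqP; apply: L_separated.
    exact: group_memB.
  have [_ _ h] := enorm_coord (y - x); apply: le_lt_trans h _.
  by rewrite !mxE; lra.
by split=> //; exact: ballxx.
Qed.

Lemma truncn_eq_dist (x y h : R) : 0 < h -> 0 <= x -> 0 <= y ->
  Num.truncn (x / h) = Num.truncn (y / h) -> `|x - y| < h.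
Proof.
move=> h0 x0 y0 e.
have := truncn_itv (divr_ge0 x0 (ltW h0)); have := truncn_itv (divr_ge0 y0 (ltW h0)).
rewrite e -natr1 !ler_pdivlMr// !ltr_pdivrMr// => /andP[? ?] /andP[? ?].
by rewrite ltr_norml; lra.
Qed.

(** Combinations of three independent vectors with coefficients in {0, ..., K}
    are (K + 1)^3 distinct points in a square of side O(K), which is covered by
    O(K^2) cells of side s / 2; two of them in the same cell would be
    at distance below s, which separation forbids. *)
Lemma discrete_rank_le2 (u : 'I_3 -> 'rV[R]_2) :
  (forall i, L (u i)) -> ~ Zindependent u.
Proof.
move=> Lu indep.
pose U := \sum_(i < 3) enorm (u i).
have U0 : 0 <= U by apply: sumr_ge0 => i _; rewrite enorm_toC normc_ge0.
pose h := s / 2; have h0 : 0 < h by rewrite divr_gt0.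
pose B := (Num.truncn (2 * U / h)).+1.
have B1 : 2 * U / h < B%:R.
  by have /andP[] := truncn_itv (divr_ge0 (mulr_ge0 (ler0n R 2) U0) (ltW h0)).
(* There are (K B + 1)^2 cells, fewer than (K + 1)^3 when K = B^2. *)
pose K := (B ^ 2)%N; pose M := (K * B)%N.
pose S (c : {ffun 'I_3 -> 'I_K.+1}) := \sum_i u i *+ c i.
have S_bound c j : `|S c 0 j| <= K%:R * U.
  rewrite /S summxE /U mulr_sumr; apply: le_trans (ler_norm_sum _ _ _) _.
  apply: ler_sum => i _; rewrite mulmxnE normrMn -[leLHS]mulr_natl.
  have uj : `|u i 0 j| <= enorm (u i).
    have [h1 h2 _] := enorm_coord (u i).
    by case: j => -[|[|//]] hj; [move: h1|move: h2];
      congr (`|u i _ _| <= _); apply/val_inj.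
  by rewrite ler_pM// ler_nat -ltnS.
pose cell (c : {ffun 'I_3 -> 'I_K.+1}) (j : 'I_2) : 'I_M.+1 :=
  inord (Num.truncn ((S c 0 j + K%:R * U) / h)).
have cellE c j : cell c j = Num.truncn ((S c 0 j + K%:R * U) / h) :> nat.
  rewrite inordK// ltnS.
  have := S_bound c j; rewrite ler_norml => /andP[b1 b2].
  rewrite -(ler_nat R); apply: (le_trans (y := (S c 0 j + K%:R * U) / h)).
    by rewrite truncn_le divr_ge0 ?(ltW h0)//; lra.
  rewrite ler_pdivrMr// /M natrM; move: B1; rewrite ltr_pdivrMr// => B1.
  have := ler0n R K; nra.
have cell_inj : injective (fun c => (cell c 0, cell c 1)).
  move=> c c' [e0 e1].
  have D j : cell c j = cell c' j -> `|S c 0 j - S c' 0 j| < h.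
    move=> /(congr1 (@nat_of_ord _)); rewrite !cellE => e.
    have := S_bound c j; have := S_bound c' j.
    rewrite !ler_norml => /andP[? ?] /andP[? ?].
    have := truncn_eq_dist h0 _ _ e; rewrite opprD addrACA subrr addr0.
    by apply; lra.
  have SE : S c - S c' = 0.
    apply: L_separated; first by apply: group_memB; exact: group_mem_sum.
    have [_ _ hs] := enorm_coord (S c - S c'); apply: le_lt_trans hs _.
    have := D _ e0; have := D _ e1; rewrite !mxE /h; lra.
  apply/ffunP => i; apply/val_inj => /=.
  have := indep (fun i => (c i)%:Z - (c' i)%:Z) _ i.
  have -> : \sum_(i < 3) u i *~ ((c i)%:Z - (c' i)%:Z) = S c - S c'.
    by rewrite /S -sumrB; apply: eq_bigr => k _; rewrite mulrzBr.
  by move=> /(_ SE) /eqP; rewrite subr_eq0 => /eqP [].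
have := leq_card _ cell_inj.
rewrite card_ffun card_prod !card_ord /M /K => H.
have : (0 < B)%N by [].
by move: (B) H => b H b0; nia.
Qed.

Lemma coordMz (x : 'rV[R]_2) (k : int) j : (x *~ k) 0 j = k%:~R * x 0 j.
Proof.
rewrite mulrzl; case: k => k; first by rewrite -!pmulrn mulmxnE.
by rewrite NegzE !mulrNz mxE -!pmulrn mulmxnE.
Qed.

Variable rho : R.
Hypothesis L_dense : forall z : R[i], exists2 x, L x & normc (toC x - z) <= rho.

(** Elements of L within rho of (t, 0) and (0, t), with t large, have a nonzero
    determinant, hence are independent even over the reals. *)
Lemma dense_rank_ge2 : exists u : 'I_2 -> 'rV[R]_2,
  (forall i, L (u i)) /\ Zindependent u.
Proof.
have r0 : 0 <= rho by have [x _] := L_dense 0; apply: le_trans; exact: normc_ge0.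
pose t := 4 * (rho + 1).
have [x Lx xt] := L_dense (t +i* 0); have [y Ly yt] := L_dense (0 +i* t).
exists (fun i => if i == 0 then x else y); split.
  by move=> i; case: ifP.
move=> c; rewrite big_ord_recr big_ord1 /=.
set c0 := c _; set c1 := c _ => e.
have bound (p q : R) : normc (p +i* q) <= rho -> `|p| <= rho /\ `|q| <= rho.
  by move=> h; have [? ? _] := normc_coord p q; split; apply: le_trans h.
have [x0 x1] : `|x 0 0 - t| <= rho /\ `|x 0 1| <= rho.
  by apply: bound; move: xt; rewrite /toC; simpc.
have [y0 y1] : `|y 0 0| <= rho /\ `|y 0 1 - t| <= rho.
  by apply: bound; move: yt; rewrite /toC; simpc.
have E j : c0%:~R * x 0 j + c1%:~R * y 0 j = 0.
  have := congr1 (fun m : 'rV[R]_2 => m 0 j) e.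
  by rewrite mxE !coordMz mxE.
have D : x 0 0 * y 0 1 - x 0 1 * y 0 0 != 0.
  move: x0 x1 y0 y1; rewrite !ler_norml /t => *; rewrite gt_eqF//; nra.
have Z0 : c0%:~R = 0 :> R.
  apply/eqP; rewrite -(mulIr_eq0 _ (mulIf D)); apply/eqP.
  transitivity ((c0%:~R * x 0 0 + c1%:~R * y 0 0) * y 0 1 -
    (c0%:~R * x 0 1 + c1%:~R * y 0 1) * y 0 0); first by ring.
  by rewrite !E !mul0r subrr.
have Z1 : c1%:~R = 0 :> R.
  apply/eqP; rewrite -(mulIr_eq0 _ (mulIf D)); apply/eqP.
  transitivity ((c0%:~R * x 0 1 + c1%:~R * y 0 1) * x 0 0 -
    (c0%:~R * x 0 0 + c1%:~R * y 0 0) * x 0 1); first by ring.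
  by rewrite !E !mul0r subrr.
move=> i; have [i0|i1] : i = 0 \/ i = 1.
  by case: i => -[|[|//]] hi; [left|right]; apply/val_inj.
  apply/eqP; rewrite -(intr_eq0 R); apply/eqP; rewrite -[RHS]Z0 /c0 i0.
  by congr (c _)%:~R; apply/val_inj.
apply/eqP; rewrite -(intr_eq0 R); apply/eqP; rewrite -[RHS]Z1 /c1 i1.
by congr (c _)%:~R; apply/val_inj.
Qed.

Lemma discrete_dense_lattice : planar_lattice L.
Proof.
split; [exact: L_group|exact: separated_isolated|split].
  exact: dense_rank_ge2.
exact: discrete_rank_le2.
Qed.

End DiscreteGroup.

(** Stability under x + y - z says exactly that Y - v is a subgroup for each v
    in Y. *)
Lemma lattice_translate (R : realType) (Y : set 'rV[R]_2) (s rho : R) :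
  0 < s ->
  (forall y y', Y y -> Y y' -> enorm (y - y') < s -> y = y') ->
  (forall z, exists2 y, Y y & normc (toC y - z) <= rho) ->
  (forall x y z, Y x -> Y y -> Y z -> Y (x + y - z)) ->
  exists (L : set 'rV[R]_2) (v : 'rV[R]_2), planar_lattice L /\ Y = translate v L.
Proof.
move=> s0 Ysep Ydense Yaff; have [v Yv _] := Ydense 0.
exists [set x | Y (x + v)], v; split; last first.
  apply/seteqP; split=> [y Yy|_ [x Yx <-] //].
  by exists (y - v); rewrite /= subrK.
apply: (@discrete_dense_lattice _ _ _ s s0 _ rho).
- split=> [|x y /set_mem /= Yx /set_mem /= Yy]; apply/mem_set => /=.
    by rewrite add0r.
  by have := Yaff _ _ _ Yx Yv Yy; rewrite opprD (addrC (- y)) addrA addrK addrAC.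
- move=> x Yx xs; have := Ysep _ _ Yx Yv; rewrite addrK => /(_ xs).
  by rewrite -[RHS]add0r => /addIr.
- move=> z; have [y Yy yz] := Ydense (z + toC v).
  exists (y - v); first by rewrite /= subrK.
  by rewrite toCB -addrA -opprD (addrC (toC v)).
Qed.

Theorem corollary5 (R : realType) (alpha : R) (halpha : badly_approximable alpha)
    (Y : set 'rV[R]_2) (hY : chabauty_limit (fermat_spiral alpha) Y) :
  exists (L : set 'rV[R]_2) (v : 'rV[R]_2),
    planar_lattice L /\ Y = translate v L.
Proof.
have Yapp := chabauty_limit_approximable hY.
have [c c0 cP] := badly_approximableP halpha.
have [s s0 sP] := limit_separated Yapp c0 cP.
have [rho rho0 rhoP] := spiral_relatively_dense halpha.
apply: (lattice_translate s0 sP (limit_relatively_dense Yapp rho0 rhoP)).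
exact: limit_parallelogram Yapp hY.1.
Qed.
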